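(* Let $d\ge 2$, $m\ge 1$ and $n\ge 0$ be integers. Then for all $x,y$, $$B_{d,n}(m;x\oplus_d y)=\sum_{k=0}^{n}\genfrac{\langle}{\rangle}{0pt}{}{n}{k}_{d}\,B_{d,k}(m;x)\,y^{n-k}.$$
   Context: For integers $d\ge1$, $n\ge 0$: $\langle n\rangle_d=\binom{n+d-1}{d}$; $\langle n\rangle_d!=\prod_{k=1}^n\langle k\rangle_d$, $\langle 0\rangle_d!=1$; $\genfrac{\langle}{\rangle}{0pt}{}{n}{k}_d=\frac{\langle n\rangle_d!}{\langle k\rangle_d!\,\langle n-k\rangle_d!}$ for $0\le k\le n$. Put $\exp_d(x)=\sum_{n\ge0}\frac{x^n}{\langle n\rangle_d!}$ and $\mathrm{T}_{d,m-1}(t)=\sum_{k=0}^{m-1}\frac{t^k}{\langle k\rangle_d!}$. The $\mathrm{S}_d$-hypergeometric Bernoulli polynomials $B_{d,n}(m;x)$ are defined by the generating function (formal power series in $t$) $$\frac{(t^m/\langle m\rangle_d!)\,\exp_d(xt)}{\exp_d(t)-\mathrm{T}_{d,m-1}(t)}=\sum_{n=0}^{\infty}B_{d,n}(m;x)\frac{t^n}{\langle n\rangle_d!}.$$ The bivariate $d$-Hoggatt polynomials are $(x\oplus_d y)^{(n)}=\sum_{k=0}^{n}\genfrac{\langle}{\rangle}{0pt}{}{n}{k}_d x^{n-k}y^k$, with $(x\oplus_d y)^{(0)}=1$. For a polynomial or power series $p(x)=\sum_j c_jx^j$, the notation $p(x\oplus_d y)$ means $\sum_j c_j (x\oplus_d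 y)^{(j)}$; so $B_{d,n}(m;x\oplus_d y)$ is obtained from $B_{d,n}(m;x)$ by replacing each power $x^j$ by $(x\oplus_d y)^{(j)}$. Equivalently, it is the coefficient of $t^n/\langle n\rangle_d!$ when $\exp_d(xt)$ in the generating function is replaced by $\sum_{j\ge0}(x\oplus_d y)^{(j)}t^j/\langle j\rangle_d!$. *)

(* Defs.v *)
From mathcomp Require Import all_boot all_order all_algebra.
From mathcomp Require Import boolp classical_sets.
Set Implicit Arguments.
Unset Strict Implicit.
Unset Printing Implicit Defensive.
Import GRing.Theory.
Local Open Scope ring_scope.

(* A formal power series \sum_n f_n t^n is represented by its coefficient
   function f. *)
Definition fps (R : Type) := nat -> R.

Definition fps_mul (R : nzRingType) (f g : fps R) : fps R :=
  fun n => \sum_(i < n.+1) f i * g (n - i)%N.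

Definition fps_sub (R : nzRingType) (f g : fps R) : fps R :=
  fun n => f n - g n.

(* The quotient f / g is the series q with q * g = f (0 if there is none).  The
   divisor need not be invertible: the one used for the Bernoulli polynomials
   has order m, as does the dividend, and the quotient exists
   (gf_bernoulli_mul) and is unique (fps_mul_inj). *)
Definition fps_div (R : nzRingType) (f g : fps R) : fps R :=
  xget (fun _ => 0) [set q : nat -> R | fps_mul q g = f]%classic.

Definition hnum (d n : nat) : nat := 'C(n + d - 1, d).

Definition hfact (d n : nat) : nat := \prod_(1 <= k < n.+1) hnum d k.

Definition hbinom (F : fieldType) (d n k : nat) : F :=
  (hfact d n)%:R / ((hfact d k)%:R * (hfact d (n - k))%:R).

(* The coefficient ring of the series in t is F[x], and x is 'X. *)

Definition exp_t (F : fieldType) (d : nat) : fps {poly F} :=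
  fun n => ((hfact d n)%:R^-1)%:P.

Definition exp_xt (F : fieldType) (d : nat) : fps {poly F} :=
  fun n => (hfact d n)%:R^-1 *: 'X^n.

(* T_{d,m-1}(t); it is 0 when m = 0. *)
Definition trunc_exp_t (F : fieldType) (d m : nat) : fps {poly F} :=
  fun k => if (k < m)%N then ((hfact d k)%:R^-1)%:P else 0.

Definition monomial_t (F : fieldType) (d m : nat) : fps {poly F} :=
  fun k => if k == m then ((hfact d m)%:R^-1)%:P else 0.

Definition gf_bernoulli (F : fieldType) (d m : nat) : fps {poly F} :=
  fps_div (fps_mul (monomial_t F d m) (exp_xt F d))
          (fps_sub (exp_t F d) (trunc_exp_t F d m)).

(* B_{d,n}(m;x), the coefficient of t^n/<n>_d! in the generating function. *)
Definition bernoulli (F : fieldType) (d m n : nat) : {poly F} :=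
  (hfact d n)%:R *: gf_bernoulli F d m n.

Definition hoggatt (F : fieldType) (d n : nat) (x y : F) : F :=
  \sum_(k < n.+1) hbinom F d n k * x ^+ (n - k) * y ^+ k.

(* p(x (+)_d y): each power x^j in p(x) is replaced by (x (+)_d y)^(j). *)
Definition hoggatt_subst (F : fieldType) (d : nat) (p : {poly F}) (x y : F) : F :=
  \sum_(j < size p) p`_j * hoggatt d j x y.

Lemma hfact_gt0 d n : (0 < d)%N -> (0 < hfact d n)%N.
Proof.
move=> d0; rewrite /hfact big_nat_cond prodn_cond_gt0 // => k.
rewrite andbT => /andP[k1 _]; rewrite /hnum bin_gt0.
by rewrite -(prednK k1) addSn subn1 /= leq_addl.
Qed.

Lemma hfact_neq0 (F : fieldType) d n :
  [pchar F] =i pred0 -> (0 < d)%N -> (hfact d n)%:R != 0 :> F.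
Proof.
by move=> /pcharf0P-> d0; rewrite -lt0n hfact_gt0.
Qed.

Lemma fps_mul_inj (R : idomainType) (g : fps R) m :
  g m != 0 -> injective (fps_mul (R := R) ^~ g).
Proof.
move=> gm0; have exg : exists i, g i != 0 by exists m.
case: (ex_minnP exg) => o go0 omin {m gm0 exg} p q pq.
apply/funext; elim/ltn_ind => n IH.
move/(congr1 (fun f => f (n + o)%N)): pq.
rewrite /fps_mul.
have no : (n < (n + o).+1)%N by rewrite ltnS leq_addr.
rewrite (bigD1 (Ordinal no)) //= [RHS](bigD1 (Ordinal no)) //= addKn.
rewrite (eq_bigr (fun i : 'I_(n + o).+1 => q i * g (n + o - i)%N)).
  by move/addIr/(mulIf go0).
move=> i; rewrite -val_eqE /= neq_ltn => /orP[/IH->//|ni].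
suff -> : g (n + o - i)%N = 0 by rewrite !mulr0.
apply/eqP; apply: contraTT ni => /omin; rewrite -leqNgt.
have io := ltn_ord i; rewrite ltnS in io.
by rewrite leq_subRL // leq_add2r.
Qed.

Lemma fps_div_ex (R : idomainType) (f g : fps R) m :
  g m \is a GRing.unit -> (forall i, (i < m)%N -> g i = 0) ->
  (forall i, (i < m)%N -> f i = 0) -> exists q, fps_mul q g = f.
Proof.
move=> gmU g0 f0.
pose fix qs n : seq R := if n is k.+1 then rcons (qs k)
  ((f (k + m)%N - \sum_(i < k) (qs k)`_i * g (k + m - i)%N) / g m) else [::].
have szq n : size (qs n) = n by elim: n => //= n IH; rewrite size_rcons IH.
pose q n := (qs n.+1)`_n.
have qE n i : (i < n)%N -> (qs n)`_i = q i.
  elim: n => // n IH; rewrite ltnS leq_eqVlt => /predU1P[-> //|lin].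
  by rewrite /= nth_rcons szq lin IH.
exists q; apply/funext => N; rewrite /fps_mul.
have [Nm|mN] := ltnP N m.
  rewrite f0 // big1 // => i _.
  by rewrite g0 ?mulr0 // (leq_ltn_trans (leq_subr _ _)).
rewrite -(subnK mN); move: (N - m)%N => n {N mN}.
rewrite -(big_mkord xpredT (fun i => q i * g (n + m - i)%N)).
rewrite (@big_cat_nat _ _ _ n.+1) //= ?ltnS ?leq_addr //.
rewrite [X in _ + X]big_nat_cond [X in _ + X]big1 ?addr0; last first.
  move=> i; rewrite andbT => /andP[ni inm]; rewrite g0 ?mulr0 //.
  by rewrite ltn_subLR // ltn_add2r.
rewrite big_nat_recr //= addKn {2}/q /= nth_rcons szq ltnn eqxx divrK //.
rewrite big_mkord [X in X + _](eq_bigr (fun i : 'I_n =>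
  (qs n)`_i * g (n + m - i)%N)); first by rewrite addrC subrK.
by move=> i _; rewrite qE.
Qed.

Lemma gf_bernoulli_mul (F : fieldType) d m :
  [pchar F] =i pred0 -> (0 < d)%N ->
  fps_mul (gf_bernoulli F d m) (fps_sub (exp_t F d) (trunc_exp_t F d m)) =
  fps_mul (monomial_t F d m) (exp_xt F d).
Proof.
move=> F0 d0; rewrite /gf_bernoulli /fps_div; set P := [set _ | _]%classic.
apply: (@xgetPex _ _ P); apply: (@fps_div_ex _ _ _ m) => [|i im|i im].
- by rewrite /fps_sub /trunc_exp_t ltnn subr0 rmorph_unit // unitfE invr_neq0 // hfact_neq0.
- by rewrite /fps_sub /trunc_exp_t im subrr.
- rewrite /fps_mul big1 // => k _; rewrite /monomial_t ifN ?mul0r //.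
  by rewrite neq_ltn (leq_ltn_trans _ im) // -ltnS.
Qed.

(* Main.v *)
Require Import Defs.
From HB Require Import structures.
From mathcomp Require Import all_boot all_order all_algebra.
From mathcomp Require Import boolp ring.
Import GRing.Theory.
Local Open Scope ring_scope.

(** Let G be the Bernoulli series, so that G D = M exp_d(xt), where D and M do
    not involve x.  An F-linear functional on F[x], applied to the coefficients
    of series in t, commutes with multiplication by D and M.  Under the
    functional x^j |-> (x (+)_d y)^(j) the series exp_d(xt) becomes
    exp_d(xt) exp_d(yt), so the image of G and G(x) exp_d(yt) have the same
    product with D, and D cancels. *)

(** Coefficient [n] of a product involves only coefficients up to [n] of the factors. Truncation
    thus carries the ring laws of polynomials over to series. *)
Lemma fps_mul_coef (R : nzRingType) (f g : fps R) (n N : nat) : (n < N)%N ->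
  fps_mul f g n = ((\poly_(i < N) f i) * (\poly_(i < N) g i))`_n.
Proof.
move=> nN; rewrite coefM; apply: eq_bigr => i _; rewrite !coef_poly.
by rewrite (leq_ltn_trans _ nN) ?(leq_ltn_trans (leq_subr _ _) nN) // -ltnS.
Qed.

Lemma fps_mulC (R : comNzRingType) (f g : fps R) : fps_mul f g = fps_mul g f.
Proof.
by apply/funext => n; rewrite !(@fps_mul_coef _ _ _ n n.+1) // mulrC.
Qed.

Lemma fps_mulA (R : nzRingType) (f g h : fps R) :
  fps_mul f (fps_mul g h) = fps_mul (fps_mul f g) h.
Proof.
apply/funext => n.
pose P (u : fps R) := \poly_(i < n.+1) u i.
have PE u i : (i <= n)%N -> (P u)`_i = u i by rewrite coef_poly ltnS => ->.
(* [P g * P h] need not be the truncation of the product series, but the two agree up to degree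
   [n]. *)
have -> : fps_mul f (fps_mul g h) n = (P f * (P g * P h))`_n.
  rewrite coefM; apply: eq_bigr => i _.
  by rewrite PE -1?ltnS // (@fps_mul_coef _ _ _ _ n.+1) // ltnS leq_subr.
rewrite mulrA coefM; apply: eq_bigr => i _.
by rewrite (@fps_mul_coef _ _ _ _ n.+1) // PE // leq_subr.
Qed.

Lemma linear_fps_mul (F : fieldType) (phi : {linear {poly F} -> F^o})
    (f : fps {poly F}) (g : fps F) :
  (fun n => phi (fps_mul f (fun k => (g k)%:P) n)) =
  fps_mul (fun n => phi (f n)) g.
Proof.
apply/funext => n; rewrite /fps_mul linear_sum; apply: eq_bigr => i _.
by rewrite mulrC mul_polyC linearZ /= mulrC.
Qed.

(** A summation bound independent of [p] lets the sums for several polynomials be combined, as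
    linearity requires. *)
Lemma hoggatt_subst_widen (F : fieldType) (d N : nat) (p : {poly F}) (x y : F) :
  (size p <= N)%N ->
  hoggatt_subst d p x y = \sum_(j < N) p`_j * hoggatt d j x y.
Proof.
move=> pN; rewrite /hoggatt_subst (big_ord_widen N
  (fun j => p`_j * hoggatt d j x y)) // big_mkcond /=.
apply: eq_bigr => j _; case: ltnP => // pj.
by rewrite nth_default ?mul0r.
Qed.

Definition hoggatt_functional (F : fieldType) (d : nat) (x y : F)
  (p : {poly F}) : F^o := hoggatt_subst d p x y.

Lemma hoggatt_functional_linear (F : fieldType) (d : nat) (x y : F) :
  linear (hoggatt_functional F d x y).
Proof.
move=> a p q; rewrite /hoggatt_functional.
pose N := maxn (size (a *: p + q)) (maxn (size p) (size q)).
rewrite !(@hoggatt_subst_widen F d N) ?leq_max ?leqnn ?orbT //.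
rewrite scaler_sumr -big_split; apply: eq_bigr => j _ /=.
by rewrite coefD coefZ mulrDl -mulrA.
Qed.

HB.instance Definition _ (F : fieldType) (d : nat) (x y : F) :=
  GRing.isLinear.Build F {poly F} F^o *:%R (hoggatt_functional F d x y)
    (hoggatt_functional_linear F d x y).

Lemma hoggatt_functionalXn (F : fieldType) (d n : nat) (x y : F) :
  hoggatt_functional F d x y 'X^n = hoggatt d n x y.
Proof.
rewrite /hoggatt_functional /hoggatt_subst size_polyXn.
rewrite big_ord_recr /= coefXn eqxx mul1r big1 ?add0r // => j _.
by rewrite coefXn ltn_eqF ?mul0r.
Qed.

Section BernoulliGeneratingFunction.

Variables (F : fieldType) (d : nat).
Hypotheses (F0 : [pchar F] =i pred0) (d0 : (0 < d)%N).

Definition exp_at (z : F) : fps F := fun n => (hfact d n)%:R^-1 * z ^+ n.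

Lemma hoggatt_functional_exp_xt (x y : F) :
  (fun n => hoggatt_functional F d x y (exp_xt F d n)) =
  fps_mul (exp_at x) (exp_at y).
Proof.
apply/funext => n; rewrite /exp_xt linearZ /= hoggatt_functionalXn.
(* In [hoggatt] the index [k] is the exponent of [y], so the factor in [y] must come first. *)
rewrite fps_mulC /hoggatt scaler_sumr; apply: eq_bigr => k _.
rewrite /GRing.scale /= /hbinom /exp_at.
by field; rewrite !hfact_neq0.
Qed.

Let divisor (m : nat) : fps F := fun n =>
  (hfact d n)%:R^-1 - (if (n < m)%N then (hfact d n)%:R^-1 else 0).

Let monomial (m : nat) : fps F := fun n =>
  if n == m then (hfact d m)%:R^-1 else 0.

Lemma linear_gf_bernoulli (phi : {linear {poly F} -> F^o}) (m : nat) :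
  fps_mul (fun n => phi (gf_bernoulli F d m n)) (divisor m) =
  fps_mul (fun n => phi (exp_xt F d n)) (monomial m).
Proof.
have divE : fps_sub (exp_t F d) (trunc_exp_t F d m) =
    fun k => (divisor m k)%:P.
  apply/funext => k; rewrite /fps_sub /exp_t /trunc_exp_t /divisor.
  by case: ifP; rewrite polyCB.
have monE : monomial_t F d m = fun k => (monomial m k)%:P.
  by apply/funext => k; rewrite /monomial_t /monomial; case: ifP.
rewrite -!linear_fps_mul -divE gf_bernoulli_mul //.
by rewrite [fps_mul (monomial_t _ _ _) _]fps_mulC monE.
Qed.

Lemma hoggatt_functional_gf_bernoulli (m : nat) (x y : F) :
  (fun n => hoggatt_functional F d x y (gf_bernoulli F d m n)) =
  fps_mul (fun n => (gf_bernoulli F d m n).[x]) (exp_at y).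
Proof.
(* The divisor has no constant term when [m] is positive, but one nonzero coefficient suffices for
   cancellation. *)
have divm : divisor m m != 0.
  by rewrite /divisor ltnn subr0 invr_neq0 // hfact_neq0.
apply: (@fps_mul_inj _ _ m divm).
rewrite linear_gf_bernoulli hoggatt_functional_exp_xt.
rewrite -[RHS]fps_mulA [fps_mul (exp_at y) (divisor m)]fps_mulC fps_mulA.
(* Evaluation at [x] turns the defining identity into G(x) D = M exp_d(xt) over [F]. *)
have := linear_gf_bernoulli (horner_eval x : {linear {poly F} -> F^o}) m.
rewrite /= /horner_eval => ->.
have -> : (fun n => (exp_xt F d n).[x]) = exp_at x.
  by apply/funext => n; rewrite /exp_xt hornerZ hornerXn.
by rewrite -!fps_mulA [fps_mul (monomial m) _]fps_mulC.
Qed.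

End BernoulliGeneratingFunction.

Theorem theorem12 (F : fieldType) (F0 : [pchar F] =i pred0) (d m n : nat)
    (hd : (2 <= d)%N) (hm : (1 <= m)%N) (x y : F) :
  hoggatt_subst d (bernoulli F d m n) x y =
  \sum_(k < n.+1) hbinom F d n k * (bernoulli F d m k).[x] * y ^+ (n - k).
Proof.
have d0 : (0 < d)%N by apply: ltnW.
rewrite -[LHS]/(hoggatt_functional F d x y (bernoulli F d m n)).
rewrite /bernoulli linearZ /=.
(* The claim is the coefficient of t^n in this identity of series, multiplied by <n>_d!. *)
rewrite [hoggatt_functional _ _ _ _ _](congr1 (fun f => f n)
  (hoggatt_functional_gf_bernoulli F d F0 d0 m x y)).
rewrite /fps_mul scaler_sumr; apply: eq_bigr => k _.
rewrite hornerZ /GRing.scale /= /hbinom /exp_at.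
by field; rewrite !hfact_neq0.
Qed.
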